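(* Let $A$ be a finite-dimensional algebra over a field $\Bbbk$ and let $n$ be a positive integer. The set $$\mathrm{Gen}_n(A):=\{(a_i)_{i=1}^n\in A^n : a_1,\dots,a_n \text{ generate } A \text{ as a } \Bbbk\text{-algebra}\}\subseteq A^n$$ of generating $n$-tuples for $A$ is a Zariski-open $\Bbbk$-defined set in $A^n$, and it is (Zariski-)dense if $n\ge 2$ and the algebra $A$ is separable.
   Context: An algebra $A$ over $\Bbbk$ is separable if it is projective as a module over its enveloping algebra $A^e:=A\otimes_{\Bbbk} A^{op}$. The finite-dimensional $\Bbbk$-vector space $A^n$ is regarded as an affine space with its natural $\Bbbk$-structure. That $\mathrm{Gen}_n(A)$ is a Zariski-open $\Bbbk$-defined set means that, for any algebraically closed field $\mathbb{K}\ge\Bbbk$, it constitutes the $\Bbbk$-rational points of an open subscheme, defined over $\Bbbk$, of the affine space over $\mathbb{K}$ attached to $A^n\otimes_{\Bbbk}\mathbb{K}$. *)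

(* Defs.v *)
From HB Require Import structures.
From mathcomp Require Import all_boot all_order all_algebra all_field.
From mathcomp Require Import mpoly.

Set Implicit Arguments.
Unset Strict Implicit.
Unset Printing Implicit Defensive.

Import GRing.Theory.
Local Open Scope ring_scope.

Definition central_map (k S : pzRingType) (phi : k -> S) : Prop :=
  forall c s, phi c * s = s * phi c.

(* [tensor_alg A phiC] is the ring A (x)_k S, for A a finite-dimensional      *)
(* k-algebra and S a ring made into a k-algebra by phi : k -> S.  The row     *)
(* vector x stands for \sum_i e_i (x) x_i, with (e_i) the basis               *)
(* [vbasis fullv] of A; the product is determined by                          *)
(* (a (x) s) * (b (x) t) = (a * b) (x) (s * t).                               *)
Section TensorAlgebra.

Variables (k : fieldType) (A : falgType k) (S : nzRingType).
Variables (phi : {rmorphism k -> S}) (phiC : central_map phi).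

Definition tensor_alg of central_map phi : Type := 'rV[S]_(\dim {:A}).

Local Notation T := (tensor_alg phiC).
Local Notation e := (vbasis {:A}).

HB.instance Definition _ := GRing.Lmodule.on T.

Definition pure_tensor (a : A) (s : S) : T :=
  \row_i (phi (coord e i a) * s).
Local Notation "a '⊗' s" := (pure_tensor a s) (at level 35).

Definition tensor_one : T := 1 ⊗ 1.

Definition tensor_mul (x y : T) : T :=
  \sum_i \sum_j (tnth e i * tnth e j) ⊗ (x 0 i * y 0 j).

Fact pure_tensorDl a b s : (a + b) ⊗ s = a ⊗ s + b ⊗ s.
Proof. by apply/rowP=> i; rewrite !mxE linearD rmorphD mulrDl. Qed.

Fact pure_tensorDr a s t : a ⊗ (s + t) = a ⊗ s + a ⊗ t.
Proof. by apply/rowP=> i; rewrite !mxE mulrDr. Qed.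

Fact pure_tensor0r a : a ⊗ 0 = 0.
Proof. by apply/rowP=> i; rewrite !mxE mulr0. Qed.

Fact pure_tensor0l s : 0 ⊗ s = 0.
Proof. by apply/rowP=> i; rewrite !mxE linear0 rmorph0 mul0r. Qed.

Fact pure_tensorZ c a s : (c *: a) ⊗ s = a ⊗ (phi c * s).
Proof. by apply/rowP=> i; rewrite !mxE linearZ rmorphM -mulrA phiC -mulrA -phiC. Qed.

Fact scale_pure_tensor s a t : s *: (a ⊗ t) = a ⊗ (s * t).
Proof. by apply/rowP=> i; rewrite !mxE !mulrA phiC. Qed.

Fact pure_tensor_suml I r (F : I -> A) s :
  (\sum_(i <- r) F i) ⊗ s = \sum_(i <- r) F i ⊗ s.
Proof.
by apply: (big_morph (fun a => a ⊗ s)) => [a b|];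
  rewrite ?pure_tensorDl ?pure_tensor0l.
Qed.

Fact tensor_basis (x : T) : x = \sum_i tnth e i ⊗ x 0 i.
Proof.
apply/rowP=> j; rewrite summxE (bigD1 j) //= big1 => [|i /negPf nij]; rewrite mxE.
  rewrite (tnth_nth 0) coord_free ?(basis_free (vbasisP _)) //.
  by rewrite eqxx rmorph1 mul1r addr0.
rewrite (tnth_nth 0) coord_free ?(basis_free (vbasisP _)) //.
by rewrite ?nij ?[_ == i]eq_sym ?nij rmorph0 mul0r.
Qed.

Fact tensor_mulDl : left_distributive tensor_mul +%R.
Proof.
move=> x y z; rewrite -big_split; apply: eq_bigr => i _.
rewrite -big_split; apply: eq_bigr => j _.
by rewrite mxE mulrDl pure_tensorDr.
Qed.

Fact tensor_mulDr : right_distributive tensor_mul +%R.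
Proof.
move=> x y z; rewrite -big_split; apply: eq_bigr => i _.
rewrite -big_split; apply: eq_bigr => j _.
by rewrite mxE mulrDr pure_tensorDr.
Qed.

Fact tensor_mul0l x : tensor_mul 0 x = 0.
Proof. by rewrite /tensor_mul !big1 // => i _; rewrite big1 // => j _;
  rewrite mxE mul0r pure_tensor0r. Qed.

Fact tensor_mul0r x : tensor_mul x 0 = 0.
Proof. by rewrite /tensor_mul !big1 // => i _; rewrite big1 // => j _;
  rewrite mxE mulr0 pure_tensor0r. Qed.

Fact tensor_mul_suml I r (F : I -> T) y :
  tensor_mul (\sum_(i <- r) F i) y = \sum_(i <- r) tensor_mul (F i) y.
Proof.
by apply: (big_morph (tensor_mul^~ y)) => [a b|];
  rewrite ?tensor_mulDl ?tensor_mul0l.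
Qed.

Fact tensor_mul_sumr I r (F : I -> T) y :
  tensor_mul y (\sum_(i <- r) F i) = \sum_(i <- r) tensor_mul y (F i).
Proof.
by apply: (big_morph (tensor_mul y)) => [a b|];
  rewrite ?tensor_mulDr ?tensor_mul0r.
Qed.

Fact mul_pure_tensor a b s t :
  tensor_mul (a ⊗ s) (b ⊗ t) = (a * b) ⊗ (s * t).
Proof.
rewrite [in RHS](coord_vbasis (memvf a)) [in RHS](coord_vbasis (memvf b)).
rewrite mulr_suml pure_tensor_suml; apply: eq_bigr => i _.
rewrite mulr_sumr pure_tensor_suml; apply: eq_bigr => j _.
rewrite -!tnth_nth -scalerAl -scalerAr !pure_tensorZ !mxE.
congr (_ ⊗ _); rewrite -mulrA (mulrA s) -(phiC _ s) -mulrA.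
by rewrite [LHS]mulrA (phiC _ (phi _)) -mulrA.
Qed.

Fact tensor_mulA : associative tensor_mul.
Proof.
move=> x y z; rewrite (tensor_basis x) !tensor_mul_suml; apply: eq_bigr => i _.
rewrite (tensor_basis y) tensor_mul_suml !tensor_mul_sumr tensor_mul_suml.
apply: eq_bigr => j _; rewrite (tensor_basis z) !tensor_mul_sumr.
by apply: eq_bigr => l _; rewrite !mul_pure_tensor !mulrA.
Qed.

Fact tensor_mul1l : left_id tensor_one tensor_mul.
Proof.
move=> x; rewrite {1}(tensor_basis x) {2}(tensor_basis x) tensor_mul_sumr.
by apply: eq_bigr => i _; rewrite mul_pure_tensor !mul1r.
Qed.

Fact tensor_mul1r : right_id tensor_one tensor_mul.
Proof.
move=> x; rewrite {1}(tensor_basis x) {2}(tensor_basis x) tensor_mul_suml.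
by apply: eq_bigr => i _; rewrite mul_pure_tensor !mulr1.
Qed.

Fact tensor_one_neq0 : tensor_one != 0.
Proof.
apply/eqP=> /rowP t10; have /eqP[] := oner_neq0 A.
rewrite (coord_vbasis (memvf 1)) big1 // => i _.
have := t10 i; rewrite !mxE mulr1 => /eqP; rewrite fmorph_eq0 => /eqP->.
by rewrite scale0r.
Qed.

HB.instance Definition _ := GRing.Zmodule_isNzRing.Build T
  tensor_mulA tensor_mul1l tensor_mul1r tensor_mulDl tensor_mulDr
  tensor_one_neq0.

End TensorAlgebra.

Section BaseChange.

Variables (k K : fieldType) (iota : {rmorphism k -> K}) (A : falgType k).

Fact central_base : central_map iota. Proof. by move=> c s; rewrite mulrC. Qed.

Definition base_change : Type := tensor_alg A central_base.

HB.instance Definition _ := GRing.NzRing.on base_change.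
HB.instance Definition _ := Vector.copy base_change 'rV[K]_(\dim {:A}).

Fact base_change_scaleAl (c : K) (x y : base_change) :
  c *: (x * y) = (c *: x) * y.
Proof.
rewrite scaler_sumr; apply: eq_bigr => i _.
rewrite scaler_sumr; apply: eq_bigr => j _.
by rewrite scale_pure_tensor mxE mulrA.
Qed.

Fact base_change_scaleAr (c : K) (x y : base_change) :
  c *: (x * y) = x * (c *: y).
Proof.
rewrite scaler_sumr; apply: eq_bigr => i _.
rewrite scaler_sumr; apply: eq_bigr => j _.
by rewrite scale_pure_tensor mxE mulrCA.
Qed.

HB.instance Definition _ :=
  GRing.Lmodule_isLalgebra.Build K base_change base_change_scaleAl.
HB.instance Definition _ :=
  GRing.Lalgebra_isAlgebra.Build K base_change base_change_scaleAr.
HB.instance Definition _ := Algebra_isFalgebra.Build K base_change.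

Definition to_base_change (a : A) : base_change :=
  pure_tensor central_base a 1.

End BaseChange.

Section Enveloping.

Variables (k : fieldType) (A : falgType k).

Definition in_alg_op (c : k) : A^c := c%:A.

Fact in_alg_op_zmod : zmod_morphism in_alg_op.
Proof. by move=> c d; rewrite /in_alg_op scalerBl. Qed.

Fact in_alg_op_monoid : monoid_morphism in_alg_op.
Proof.
split=> [|c d]; first exact: scale1r.
by rewrite /in_alg_op mulrC; exact: (rmorphM (in_alg A)).
Qed.

HB.instance Definition _ :=
  GRing.isZmodMorphism.Build k A^c in_alg_op in_alg_op_zmod.
HB.instance Definition _ :=
  GRing.isMonoidMorphism.Build k A^c in_alg_op in_alg_op_monoid.

Fact central_in_alg_op : central_map in_alg_op.
Proof.
move=> c s; apply: (etrans (y := c *: (s : A))).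
  exact: (mulr_algr c (s : A)).
exact/esym/(mulr_algl c (s : A)).
Qed.

(* A (x) A^op; [A^c] is the converse ring of A.                               *)
Definition enveloping_alg : Type := tensor_alg A central_in_alg_op.
HB.instance Definition _ := GRing.NzRing.on enveloping_alg.

(* A as a left module over its enveloping algebra: (a (x) b) . m = a * m * b. *)
Definition regular_bimodule : Type := A.
HB.instance Definition _ := GRing.Zmodule.on regular_bimodule.

Definition enveloping_act (x : enveloping_alg) (m : regular_bimodule) :
    regular_bimodule :=
  \sum_i tnth (vbasis {:A}) i * (m : A) * (x 0 i : A).

Local Notation "a '⊗' b" := (pure_tensor central_in_alg_op a b) (at level 35).

Fact enveloping_act_pure (a : A) (b : A^c) m :
  enveloping_act (a ⊗ b) m = a * (m : A) * (b : A).
Proof.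
rewrite [in RHS](coord_vbasis (memvf a)) !mulr_suml; apply: eq_bigr => i _.
rewrite mxE -tnth_nth -!scalerAl scalerAr; congr (_ * _).
by rewrite central_in_alg_op; exact: mulr_algl.
Qed.

Fact enveloping_actDl m : {morph enveloping_act^~ m : x y / x + y}.
Proof.
by move=> x y; rewrite -big_split; apply: eq_bigr => i _; rewrite mxE mulrDr.
Qed.

Fact enveloping_actDr : right_distributive enveloping_act +%R.
Proof.
move=> x m m'; rewrite -big_split; apply: eq_bigr => i _.
by rewrite -[RHS](@mulrDl A) -(@mulrDr A).
Qed.

Fact enveloping_act0r x : enveloping_act x 0 = 0.
Proof. by rewrite /enveloping_act big1 // => i _; rewrite mulr0 mul0r. Qed.

Fact enveloping_act0l m : enveloping_act 0 m = 0.
Proof. by rewrite /enveloping_act big1 // => i _; rewrite mxE mulr0. Qed.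

Fact enveloping_act_suml I r (F : I -> enveloping_alg) m :
  enveloping_act (\sum_(i <- r) F i) m = \sum_(i <- r) enveloping_act (F i) m.
Proof.
by apply: (big_morph (enveloping_act^~ m)) => [x y|];
  rewrite ?enveloping_actDl ?enveloping_act0l.
Qed.

Fact enveloping_act_sumr I r (F : I -> regular_bimodule) x :
  enveloping_act x (\sum_(i <- r) F i) = \sum_(i <- r) enveloping_act x (F i).
Proof.
by apply: (big_morph (enveloping_act x)) => [m m'|];
  rewrite ?enveloping_actDr ?enveloping_act0r.
Qed.

Fact enveloping_actA x y m :
  enveloping_act x (enveloping_act y m) = enveloping_act (x * y) m.
Proof.
rewrite (tensor_basis x) mulr_suml !enveloping_act_suml; apply: eq_bigr => i _.
rewrite (tensor_basis y) mulr_sumr !enveloping_act_suml enveloping_act_sumr.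
apply: eq_bigr => j _; rewrite [_ * _]mul_pure_tensor !enveloping_act_pure.
by rewrite [_ * _ in X in _ = _ * X]/GRing.mul /= !mulrA.
Qed.

Fact enveloping_act1 : left_id 1 enveloping_act.
Proof. by move=> m; rewrite [1]/(1 ⊗ 1) enveloping_act_pure mul1r mulr1. Qed.

HB.instance Definition _ :=
  GRing.Zmodule_isLmodule.Build enveloping_alg regular_bimodule
    enveloping_actA enveloping_act1 enveloping_actDr enveloping_actDl.

End Enveloping.

Definition projective (R : pzRingType) (M : lmodType R) : Prop :=
  forall (P Q : lmodType R) (g : {linear P -> Q}) (f : {linear M -> Q}),
    (forall q, exists p, g p = q) ->
  exists h : {linear M -> P}, forall m, g (h m) = f m.

Definition separable_alg (k : fieldType) (A : falgType k) : Prop :=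
  @projective (enveloping_alg A) (regular_bimodule A).

(* [<<1 & a>>] is the unital k-subalgebra generated by a.                     *)
Definition generating (k : fieldType) (A : falgType k) n (a : n.-tuple A) : Prop :=
  <<1 & a>>%VS = fullv.

(* Affine space A^n is identified with affine space of dimension n * \dim A    *)
(* through the coordinates in [vbasis fullv] of the components, and           *)
(* (A (x)_k K)^n accordingly through the basis (e_i (x) 1).                   *)
Definition coord_row (k : fieldType) (A : falgType k) (a : A) :
    'rV[k]_(\dim {:A}) :=
  \row_i coord (vbasis {:A}) i a.

Definition point (F : fieldType) n d (x : n.-tuple 'rV[F]_d) :
    'I_(n * d) -> F :=
  fun p => mxvec (\matrix_(i < n) tnth x i) 0 p.

(* F-points of the open subscheme of affine N-space over F that is the        *)
(* complement of the common zero locus of the polynomials in P.               *)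
Definition open_points (F : fieldType) N (P : {mpoly F[N]} -> Prop)
    (v : 'I_N -> F) : Prop :=
  exists2 f, P f & f.@[v] != 0.

(* The open subscheme given by P, base changed along iota.                    *)
Definition extend_open (k K : fieldType) (iota : {rmorphism k -> K}) N
    (P : {mpoly k[N]} -> Prop) : {mpoly K[N]} -> Prop :=
  fun g => exists2 f, P f & g = map_mpoly iota f.

Definition zariski_dense (F : fieldType) N (V : ('I_N -> F) -> Prop) : Prop :=
  forall P : {mpoly F[N]} -> Prop,
    (exists v, open_points P v) -> exists2 v, open_points P v & V v.

Definition infinite_field (F : fieldType) : Prop :=
  forall s : seq F, exists c, c \notin s.

(* Main.v *)
From HB Require Import structures.
Require Import Defs.
From mathcomp Require Import all_boot all_order all_algebra all_field.
From mathcomp Require Import mpoly.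
From Stdlib Require Import Classical_Prop.

Set Implicit Arguments.
Unset Strict Implicit.
Unset Printing Implicit Defensive.

Import GRing.Theory.
Local Open Scope ring_scope.

(** The open set is cut out by the determinants of the coordinates of dim A words in
    n generic elements of A (x) k[X].

    Density only requires one of these determinants to be a nonzero polynomial, that
    is, n generators of A (x) L for some field L containing k.  A separability
    idempotent survives every base change and makes A (x) L von Neumann regular, by
    averaging the linear projection onto a principal left ideal.  Over infinite fields
    L containing k, choose orthogonal idempotents f_i of sum 1 in A (x) L, as many as
    possible.  Then f_i (A (x) L) f_i = L f_i: otherwise the minimal polynomial of some
    x in this division ring has degree at least 2, and x - t is a zero divisor after
    adjoining a root t of it, which gives an idempotent splitting f_i.  By regularity
    each f_i (A (x) L) f_j is at most one-dimensional, spanned by some u_ij, and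
    sum_i lam_i f_i and sum_ij u_ij generate A (x) L as soon as the lam_i are
    distinct. *)

(** * Infinite fields and field extensions *)

Lemma infinite_uniq (F : fieldType) : infinite_field F ->
  forall N, exists2 s : seq F, uniq s & size s = N.
Proof.
move=> infF; elim=> [|N [s us <-]]; first by exists [::].
by have [c cs] := infF s; exists (c :: s); rewrite //= cs.
Qed.

Lemma infinite_inj (F : fieldType) (f : nat -> F) : injective f -> infinite_field F.
Proof.
move=> injf s; pose t := [seq f i | i <- iota 0 (size s).+1].
have /allPn[c _ cs] : ~~ all (mem s) t; last by exists c.
apply/negP=> /allP sts; have ut : uniq t by rewrite map_inj_uniq ?iota_uniq.
by have := uniq_leq_size ut sts; rewrite size_map size_iota ltnn.
Qed.

Lemma infinite_morph (F L : fieldType) (iota : {rmorphism F -> L}) :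
  infinite_field F -> infinite_field L.
Proof.
move=> infF s; have [t ut szt] := infinite_uniq infF (size s).+1.
have /allPn[c _ cs] : ~~ all (mem s) (map iota t); last by exists c.
apply/negP=> /allP sts; have := uniq_leq_size _ sts.
by rewrite map_inj_uniq ?size_map ?szt ?ltnn => [/(_ ut)|] //; apply: fmorph_inj.
Qed.

(** As in Euclid's argument, a root of [1 + \prod_(c <- s) ('X - c)] cannot lie in [s]. The empty
    [s] is set apart because the polynomial is then constant. *)
Lemma infinite_closed (K : closedFieldType) : infinite_field K.
Proof.
move=> s; pose p := \prod_(c <- s) ('X - c%:P) + 1 : {poly K}.
have [szs|szs] := posnP (size s); first by exists 0; rewrite (size0nil szs).
have /closed_rootP[c] : size p != 1%N.
  by rewrite size_polyDl size_prod_XsubC ?size_polyC_leq1 // ?oner_neq0 ?size_poly1 ?ltnS // -lt0n.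
rewrite /root hornerD hornerC => pc; exists c; apply/negP=> cs.
have := root_prod_XsubC s c; rewrite cs /root => /eqP q0.
by move: pc; rewrite q0 add0r oner_eq0.
Qed.

(** The rational function field k(X) works, since the powers of X are pairwise distinct. *)
Lemma exists_infinite_extension (k : fieldType) :
  exists (L : fieldType) (iota : {rmorphism k -> L}), infinite_field L.
Proof.
exists {fraction {poly k}}, (@tofrac {poly k} \o polyC).
apply: (@infinite_inj _ (fun i => @tofrac {poly k} 'X^i)) => i j /eqP.
by rewrite tofrac_eq => /eqP/(congr1 (size \o val)); rewrite /= !size_polyXn => -[].
Qed.

(** The class of X is a root in L[X]/(h), where [h] is the monic associate of [p]. *)
Lemma exists_root_extension (L : fieldType) (p : {poly L}) : irreducible_poly p ->
  exists (L' : fieldType) (j : {rmorphism L -> L'}) (t : L'), root (map_poly j p) t.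
Proof.
move=> irr_p.
have lp : lead_coef p != 0 by rewrite lead_coef_eq0 irredp_neq0.
pose h := (lead_coef p)^-1 *: p.
have hp : h %= p by rewrite eqp_scale // invr_eq0.
have mih : monic_irreducible_poly h.
  split; last by rewrite monicE lead_coefZ mulVf.
  split; first by rewrite (eqp_size hp) irr_p.1.
  by move=> q sq; rewrite (eqp_dvdr _ hp) => /(irr_p.2 _ sq) /eqp_trans; apply; rewrite eqp_sym.
exists {poly %/ h with mih}, (qpolyC h), (in_qpoly h 'X).
have sz : forall q : {poly L}, (map_poly (qpolyC h) q).[in_qpoly h 'X] = in_qpoly h q.
  elim/poly_ind=> [|q c IH]; first by rewrite rmorph0 horner0 rmorph0.
  rewrite rmorphD rmorphM /= map_polyX map_polyC hornerMXaddC IH rmorphD rmorphM.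
  congr (_ + _); apply/val_inj/esym/in_qpoly_small.
  by rewrite (leq_ltn_trans (size_polyC_leq1 _)) ?size_mk_monic_gt1.
have hh : in_qpoly h h = 0.
  by apply/val_inj; rewrite /= (mk_monicE mih) Pdiv.RingMonic.rmodpp // mih.
have ep : p = lead_coef p *: h by rewrite scalerA mulfV // scale1r.
by rewrite /root sz ep in_qpolyZ hh scaler0.
Qed.

Lemma meval_muni (F : fieldType) n (p : {mpoly F[n.+1]}) (v : 'I_n -> F) (c : F) :
  (map_poly (meval v) (muni p)).[c] =
  p.@[fun i => if unlift ord_max i is Some j then v j else c].
Proof.
rewrite muniE raddf_sum horner_sum mevalE; apply: eq_bigr => m _.
rewrite /= map_polyZ map_polyXn hornerZ hornerXn /= mevalZ mevalX -mulrA; congr (_ * _).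
rewrite big_ord_recr /= unlift_none; congr (_ * _); apply: eq_bigr => i _.
have ->: widen_ord (leqnSn n) i = lift ord_max i by apply/val_inj; rewrite /= /bump leqNgt ltn_ord.
by rewrite liftK mnmE; congr (_ ^+ m _); apply/val_inj; rewrite /= /bump leqNgt ltn_ord.
Qed.

(** The leading coefficient of [p] reappears in [muni p]: the exponent of the last variable in [m0]
    selects a coefficient of [muni p], and the other exponents select a monomial in it. *)
Lemma muni_neq0 (F : fieldType) n (p : {mpoly F[n.+1]}) : p != 0 -> muni p != 0.
Proof.
move=> p0; pose m0 := mlead p; apply: contraNneq p0 => up0.
rewrite -mleadc_eq0 -/m0.
have: (((muni p)`_(m0 ord_max))@_[multinom (m0 (widen_ord (leqnSn n) i)) | i < n]) = 0.
  by rewrite up0 coef0 mcoeff0.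
rewrite muniE coef_sum raddf_sum /=; have [m0p|/memN_msupp_eq0-> //] := boolP (m0 \in msupp p).
rewrite (bigD1_seq m0) ?msupp_uniq //= big1 => [|m mm0].
  by rewrite addr0 coefZ coefXn eqxx mulr1 mcoeffZ mcoeffX eqxx mulr1 => ->.
rewrite coefZ coefXn; case: eqP => [em|_]; last by rewrite mulr0 mcoeff0.
rewrite mulr1 mcoeffZ mcoeffX; case: eqP => [|_]; last by rewrite mulr0.
move=> /mnmP er; case/eqP: mm0; apply/mnmP=> i.
have [j ->|->] := unliftP ord_max i; last by rewrite em.
have ->: lift ord_max j = widen_ord (leqnSn n) j by apply/val_inj; rewrite /= /bump leqNgt ltn_ord.
by have := er j; rewrite !mnmE.
Qed.

Lemma horner_neq0 (F : fieldType) (p : {poly F}) :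
  infinite_field F -> p != 0 -> exists c, p.[c] != 0.
Proof.
move=> /infinite_uniq /(_ (size p)) [s us szs] p0.
have /allPn[c _ pc] : ~~ all (root p) s; last by exists c.
by apply/negP=> /(max_poly_roots p0) /(_ us); rewrite szs ltnn.
Qed.

Lemma meval_neq0 (F : fieldType) n (p : {mpoly F[n]}) :
  infinite_field F -> p != 0 -> exists v, p.@[v] != 0.
Proof.
move=> infF; elim: n p => [|n IHn] p p0.
  exists (fun=> 0); rewrite mevalE; move: (p0); rewrite -mleadc_eq0 => l0.
  rewrite (bigD1_seq (mlead p)) ?mlead_supp ?msupp_uniq //= big_ord0 mulr1 big1 ?addr0 //.
  by move=> m /eqP[]; apply/mnmP; case.
(* At a point where the leading coefficient in the last variable does not vanish, the specialised
   univariate polynomial is nonzero. *)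
have /= := muni_neq0 p0; rewrite -lead_coef_eq0 => /IHn[v qv].
have [|c pc] := @horner_neq0 _ (map_poly (meval v) (muni p)) infF.
  by apply: contraNneq qv => q0; rewrite -coef_map q0 coef0.
by exists (fun i => if unlift ord_max i is Some j then v j else c); rewrite -meval_muni.
Qed.

(** * Words in the generators *)

Section TensorMap.

Variables (k : fieldType) (A : falgType k) (S S' : nzRingType).
Variables (phi : {rmorphism k -> S}) (phiC : central_map phi).
Variables (phi' : {rmorphism k -> S'}) (phiC' : central_map phi').
Variables (psi : {rmorphism S -> S'}) (psiE : forall c, psi (phi c) = phi' c).

(** The compatibility proof is an explicit argument, so that the ring morphism instances below can
    be attached to [tensor_map psiE]. *)
Definition tensor_map of (forall c, psi (phi c) = phi' c) :=
  fun x : tensor_alg A phiC => map_mx psi x : tensor_alg A phiC'.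

Lemma tensor_map_pure a s :
  tensor_map psiE (pure_tensor phiC a s) = pure_tensor phiC' a (psi s).
Proof. by apply/rowP=> i; rewrite !mxE rmorphM psiE. Qed.

Fact tensor_map_zmod : zmod_morphism (tensor_map psiE).
Proof. by move=> x y; apply: map_mxB. Qed.

HB.instance Definition _ := GRing.isZmodMorphism.Build _ _ (tensor_map psiE) tensor_map_zmod.

Fact tensor_map_monoid : monoid_morphism (tensor_map psiE).
Proof.
split=> [|x y]; first by rewrite [1]/(tensor_one A phiC) tensor_map_pure rmorph1.
rewrite [x * y]/(tensor_mul x y) raddf_sum; apply: eq_bigr => i _.
by rewrite raddf_sum; apply: eq_bigr => j _; rewrite /= tensor_map_pure rmorphM !mxE.
Qed.

HB.instance Definition _ := GRing.isMonoidMorphism.Build _ _ (tensor_map psiE) tensor_map_monoid.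

End TensorMap.

Section Words.

Definition word (R : pzRingType) n (a : 'I_n -> R) (w : seq 'I_n) : R := \prod_(l <- w) a l.

Lemma rmorph_word (R R' : pzRingType) n (f : {rmorphism R -> R'}) (a : 'I_n -> R) w :
  f (word a w) = word (f \o a) w.
Proof. exact: rmorph_prod. Qed.

Lemma eq_word (R : pzRingType) n (a b : 'I_n -> R) w : a =1 b -> word a w = word b w.
Proof. by move=> ab; apply: eq_bigr. Qed.

End Words.

Section GeneratingCriterion.

Variables (F : fieldType) (R : falgType F).

(** Words of length at most [m], with repetitions; the recursion mirrors (1 + V)^(m+1) = (1 + V)^m +
    V (1 + V)^m. *)
Fixpoint words_upto n m : seq (seq 'I_n) :=
  if m is m'.+1 then words_upto n m' ++ [seq l :: w | l <- enum 'I_n, w <- words_upto n m']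
  else [:: [::]].

Lemma sumv_seq_sub (I : eqType) (r : seq I) (V : I -> {vspace R}) (W : {vspace R}) :
  (forall i, i \in r -> V i <= W)%VS -> (\sum_(i <- r) V i <= W)%VS.
Proof.
move=> VW; rewrite big_seq; apply: (big_ind (fun U => U <= W)%VS); first exact: sub0v.
  by move=> U1 U2 U1W U2W; rewrite subv_add U1W.
exact: VW.
Qed.

Lemma expv_sub_words n (a : n.-tuple R) m :
  ((1 + <<a>>) ^+ m <= <<[seq word (tnth a) w | w <- words_upto n m]>>)%VS.
Proof.
elim: m => [|m IHm] /=.
  by rewrite expv0 span_seq1 /word big_nil.
rewrite expvSl prodvDl prod1v subv_add; apply/andP; split.
  apply: subv_trans IHm _; apply: sub_span => x; rewrite map_cat mem_cat => -> //.
apply: subv_trans (prodvSr _ IHm) _; rewrite span_def big_distrl /=.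
apply: sumv_seq_sub => x /tnthP[l ->].
rewrite [in X in (X <= _)%VS]span_def big_distrr /=; apply: sumv_seq_sub => _ /mapP[w wm ->].
rewrite prodv_line -memvE map_cat; apply: memv_span; rewrite mem_cat; apply/orP; right.
apply/mapP; exists (l :: w); last by rewrite /word big_cons.
by apply/allpairsP; exists (l, w); rewrite mem_enum.
Qed.

(** The generated subalgebra is a sum of finitely many powers of [1 + <<a>>], so finitely many words
    are enough. *)
Lemma words_span n (a : n.-tuple R) : exists ws : seq (seq 'I_n),
  (<<1 & a>> <= <<[seq word (tnth a) w | w <- ws]>>)%VS.
Proof.
pose g m := [seq word (tnth a) w | w <- words_upto n m].
suff [ws sws] : exists ws, (\sum_(i < \dim {:R}) <<g i>> <= <<[seq word (tnth a) w | w <- ws]>>)%VS.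
  exists ws; apply: subv_trans _ sws; apply/subv_sumP=> i _.
  by rewrite (sumv_sup i) //; apply: expv_sub_words.
elim: (\dim _) => [|m [ws sws]]; first by exists [::]; rewrite big_ord0 sub0v.
exists (ws ++ words_upto n m); rewrite big_ord_recr /= map_cat span_cat.
exact: addvS.
Qed.

Lemma word_gen n (a : n.-tuple R) w : word (tnth a) w \in <<1 & a>>%VS.
Proof.
rewrite /word; apply: (big_ind (fun x => x \in <<1 & a>>%VS)).
- by rewrite memvE sub1_agenv.
- by move=> x y xB yB; rewrite agenvE memvM.
by move=> l _; apply: seqv_sub_adjoin; rewrite mem_tnth.
Qed.

(** Coordinates are left arbitrary so that the criterion applies both to A and to its base changes,
    always with determinants of size [\dim {:A}]. *)
Lemma generatingP d (c : {linear R -> 'rV[F]_d}) n (a : n.-tuple R) :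
    bijective c ->
  generating a <->
  exists w : 'I_d -> seq 'I_n,
    \det (\matrix_(i, j) c (word (tnth a) (w i)) 0 j) != 0.
Proof.
move=> [c' cK c'K]; split=> [ga | [w detw]].
  have [ws] := words_span a; rewrite ga => sws.
  pose M := \matrix_(i < size ws, j < d) c (word (tnth a) (tnth (in_tuple ws) i)) 0 j.
  have fM : row_full M.
    rewrite -sub1mx; apply/row_subP => i; rewrite -[row i _]c'K; move: (row i _) => u.
    have c'u : c' u \in <<in_tuple [seq word (tnth a) w | w <- ws]>>%VS.
      exact/(subvP sws)/memvf.
    rewrite (coord_span c'u) linear_sum; apply: summx_sub => j _; rewrite linearZ scalemx_sub //=.
    case: j => j; rewrite size_map => /= lj.
    have -> : c [seq word (tnth a) w | w <- ws]`_j = row (Ordinal lj) M.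
      by apply/rowP => l; rewrite (nth_map [::]) // !mxE (tnth_nth [::]).
    exact: row_sub.
  (* The coordinate rows of the words have full rank, so some [d] of them form an invertible
     matrix. *)
  exists (fun i => tnth (in_tuple ws) (fullrankfun fM i)).
  rewrite -unitfE -unitmxE; set N := \matrix_(i, j) _.
  have ->: N = rowsub (fullrankfun fM) M by apply/matrixP=> i j; rewrite !mxE.
  exact: fullrowsub_unit.
apply/eqP; rewrite eqEsubv subvf /=; apply/subvP => x _.
set M := \matrix_(_, _) _ in detw.
have uM : M \in unitmx by rewrite unitmxE unitfE.
have ->: x = \sum_i (c x *m invmx M) 0 i *: word (tnth a) (w i).
  apply: (can_inj cK); rewrite linear_sum /=; rewrite -[LHS](mulmxKV uM) mulmx_sum_row.
  by apply: eq_bigr => i _; rewrite linearZ; congr (_ *: _); apply/rowP => j; rewrite !mxE.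
by apply: memv_suml => i _; rewrite memvZ ?word_gen.
Qed.

End GeneratingCriterion.

(** * Von Neumann regular algebras *)

Section RegularAlgebra.

Variables (F : fieldType) (R : falgType F).

Lemma amullE (a x : R) : amull a x = a * x. Proof. by rewrite lfunE. Qed.

Lemma amulrE (a x : R) : amulr a x = x * a. Proof. by rewrite lfunE. Qed.

(* Says that [\sum_i E i (x) S i] is a separability idempotent, with its invariance
   under [a] written as a pair of transposed matrix actions. *)
Definition casimir d (E S : 'I_d -> R) : Prop :=
  \sum_i E i * S i = 1 /\
  forall a, exists M : 'M[F]_d,
    (forall i, a * E i = \sum_l M l i *: E l) /\ (forall l, S l * a = \sum_i M l i *: S i).

Definition regular : Prop := forall x : R, exists y, x * y * x = x.

(* Averaging the linear projection [P] onto the left ideal generated by [x] gives a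
   left [R]-linear projection [T], whence [x = T x = x * T 1] with [T 1] in this ideal. *)
Lemma casimir_regular d (E S : 'I_d -> R) : casimir E S -> regular.
Proof.
move=> [ES1 cas] x; pose V := limg (amulr x); pose P := projv V.
have memV z : z * x \in V by rewrite -amulrE memv_img ?memvf.
pose T z := \sum_i E i * P (S i * z).
have TM a z : a * T z = T (a * z).
  have [M [aE Sa]] := cas a; rewrite mulr_sumr.
  transitivity (\sum_i \sum_l M l i *: (E l * P (S i * z))).
    apply: eq_bigr => i _; rewrite mulrA aE mulr_suml.
    by apply: eq_bigr => l _; rewrite scalerAl.
  rewrite exchange_big; apply: eq_bigr => l _.
  rewrite mulrA Sa mulr_suml linear_sum mulr_sumr; apply: eq_bigr => i _.
  by rewrite -scalerAl linearZ /= scalerAr.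
have Tx : T x = x.
  rewrite -[RHS]mul1r -ES1 mulr_suml; apply: eq_bigr => i _.
  by rewrite /P projv_id // mulrA.
have /memv_imgP[y _ T1] : T 1 \in V.
  apply: memv_suml => i _; have /memv_imgP[z _ ->] := memv_proj V (S i * 1).
  by rewrite amulrE mulrA memV.
by exists y; rewrite -mulrA -{3}Tx -[X in T X]mulr1 -TM T1 amulrE.
Qed.

Definition idem_decomp (I : finType) (f : I -> R) : Prop :=
  [/\ forall i j, f i * f j = if i == j then f i else 0, \sum_i f i = 1
    & forall i, f i != 0].

(** Nonzero orthogonal idempotents are linearly independent: multiplying a relation by [f i]
    isolates its [i]-th coefficient. This bound makes the refinement process stop. *)
Lemma idem_decomp_card (I : finType) (f : I -> R) : idem_decomp f -> (#|I| <= \dim {:R})%N.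
Proof.
move=> [ff f1 f0]; pose X := [tuple f (enum_val i) | i < #|I|].
suff /eqP : free X by rewrite size_tuple => <-; rewrite dimvS ?subvf.
apply/freeP => c cX i.
have {}cX : \sum_j c j *: f (enum_val j) = 0.
  by rewrite -[RHS]cX; apply: eq_bigr => j _; rewrite -tnth_nth tnth_mktuple.
apply/eqP; apply: contraTT isT => ci.
have /eqP := congr1 ( *%R^~ (f (enum_val i))) cX.
rewrite mul0r mulr_suml (bigD1 i) //= big1 => [|j ji].
  rewrite -scalerAl ff eqxx addr0 scaler_eq0.
  by rewrite (negPf ci) (negPf (f0 _)).
by rewrite -scalerAl ff (inj_eq enum_val_inj) (negPf ji) scaler0.
Qed.

Lemma idem_decomp_split (I : finType) (f : I -> R) i e : idem_decomp f ->
  e * e = e -> f i * e = e -> e * f i = e -> e != 0 -> e != f i ->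
  idem_decomp (fun o : option I => if o is Some j then (if j == i then f i - e else f j) else e).
Proof.
move=> [ff f1 f0] ee fe ef e0 ei.
have fie j : j != i -> f j * e = 0 by move=> ji; rewrite -fe mulrA ff (negPf ji) mul0r.
have eif j : j != i -> e * f j = 0.
  by move=> ji; rewrite -ef -mulrA ff eq_sym (negPf ji) mulr0.
split.
- case=> [j|] [l|] //=.
  + rewrite (inj_eq Some_inj); have [->|ji] := eqVneq j i.
      rewrite [i == l]eq_sym; case: (eqVneq l i) => [_|li].
        by rewrite mulrBl !mulrBr ff eqxx fe ef ee subrr subr0.
      by rewrite mulrBl ff eq_sym (negPf li) eif // subrr.
    case: (eqVneq l i) => [->|li]; last by rewrite ff.
    by rewrite mulrBr ff (negPf ji) fie // subrr.
  + by case: (eqVneq j i) => [_|ji]; [rewrite mulrBl fe ee subrr | rewrite fie].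
  by case: (eqVneq l i) => [_|li]; [rewrite mulrBr ef ee subrr | rewrite eif].
- rewrite (bigD1 None) //= (reindex_omap Some id) => [/=|[]] //.
  under eq_bigl do rewrite eqxx.
  rewrite (bigD1 i) //= eqxx addrA addrC [e + _]addrC subrK -f1 [RHS](bigD1 i) //=.
  by rewrite addrC; congr (_ + _); apply: eq_bigr => j /negPf->.
by case=> [j|] //; case: (eqVneq j i) => // _; rewrite subr_eq0 eq_sym.
Qed.

(** Regularity turns the zero divisors [w * y = 0] of the corner into an idempotent [e = y * z * f],
    where [y * z * y = y]. It is nonzero because [e * y = y], and differs from [f] because
    [w * e = 0] whereas [w * f = w]. *)
Lemma corner_idempotent (f w y : R) : regular -> f * f = f ->
  f * y = y -> y * f = y -> w * f = w -> w != 0 -> y != 0 -> w * y = 0 ->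
  exists e, [/\ e * e = e, f * e = e, e * f = e, e != 0 & e != f].
Proof.
move=> reg ff fy yf wf w0 y0 wy; have [z yzy] := reg y.
exists (y * z * f); have eyy : y * z * f * y = y by rewrite -mulrA fy.
split.
- by rewrite [in RHS]/= !mulrA eyy.
- by rewrite !mulrA fy.
- by rewrite -!mulrA ff.
- by apply: contraNneq y0 => e0; rewrite -eyy e0 mul0r.
by apply: contraNneq w0 => ef; rewrite -wf -ef !mulrA wy !mul0r.
Qed.

(** A nonzero [u] in the corner between [f i] and [f j] has a quasi-inverse [y'] in the opposite
    corner, with [y' * u = f j]. Any [z] of the first corner is then [(z * y') * u], and [z * y'] is
    a multiple of [f i]. *)
Lemma corner_dim1 (I : finType) (f : I -> R) : regular -> idem_decomp f ->
    (forall i x, exists c, f i * x * f i = c *: f i) ->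
  forall i j, exists2 u, f i * u * f j = u & forall z, exists c, f i * z * f j = c *: u.
Proof.
move=> reg [ff f1 f0] dim1 i j; pose V := limg (amulr (f j) \o amull (f i))%VF.
have memV z : f i * z * f j \in V.
  have -> : f i * z * f j = (amulr (f j) \o amull (f i))%VF z by rewrite comp_lfunE amullE amulrE.
  by rewrite memv_img ?memvf.
have VP v : v \in V -> f i * v * f j = v.
  move=> /memv_imgP[z _ ->]; rewrite comp_lfunE amullE amulrE.
  by rewrite !mulrA ff eqxx -!mulrA ff eqxx.
exists (vpick V) => [|z]; first by rewrite VP ?memv_pick.
have := memv_pick V; set u := vpick V => uV.
(* [vpick V] vanishes only when the corner [V] is zero. *)
have [u0|u0] := eqVneq u 0.
  exists 0; apply/eqP; rewrite scale0r -memv0 -[0%VS](_ : V = _) ?memV //.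
  by apply/eqP; rewrite -vpick0 -/u u0.
have [y uyu] := reg u.
have fu : f i * u = u by rewrite -(VP u uV) !mulrA ff eqxx.
have uf : u * f j = u by rewrite -(VP u uV) -!mulrA ff eqxx.
pose y' := f j * y * f i.
have uyu' : u * y' * u = u by rewrite /y' !mulrA uf -mulrA fu.
have [c' y'u] := dim1 j (y * f i * u).
have {}y'u : y' * u = f j.
  (* Then [u = u * y' * u = c' *: u], which forces [c' = 1]. *)
  have y'uc : y' * u = c' *: f j by rewrite -y'u /y' !mulrA -[in RHS]mulrA uf.
  move: uyu'; rewrite -mulrA y'uc -scalerAr uf => /eqP.
  rewrite -[X in _ == X]scale1r -subr_eq0 -scalerBl scaler_eq0 (negPf u0) orbF subr_eq0.
  by move/eqP->; rewrite scale1r.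
have [b zy] := dim1 i (z * y').
exists b; rewrite -[in RHS]fu scalerAl -zy /y' -!mulrA.
by congr (_ * (_ * _)); rewrite !mulrA -(mulrA _ (f i) (f i)) ff eqxx -/y' y'u.
Qed.

Lemma horner_diag (I : finType) (f : I -> R) (lam : I -> F) (p : {poly F}) : idem_decomp f ->
  horner_alg (\sum_i lam i *: f i) p = \sum_i p.[lam i] *: f i.
Proof.
move=> [ff f1 f0]; elim/poly_ind: p => [|p c IHp].
  by rewrite rmorph0 big1 // => i _; rewrite horner0 scale0r.
rewrite rmorphD rmorphM /= horner_algX horner_algC IHp -f1 scaler_sumr mulr_suml -big_split.
apply: eq_bigr => i _; rewrite hornerMXaddC scalerDl; congr (_ + _).
rewrite mulr_sumr (bigD1 i) //= big1 ?addr0 => [|j ji].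
  by rewrite -scalerAl -scalerAr ff eqxx scalerA.
by rewrite -scalerAl -scalerAr ff eq_sym (negPf ji) !scaler0.
Qed.

Lemma idem_decomp_generated (I : finType) (f : I -> R) (lam : I -> F) (u : I -> I -> R)
    (B : {aspace R}) :
    idem_decomp f -> injective lam ->
    (forall i j, f i * u i j * f j = u i j) ->
    (forall i j z, exists c, f i * z * f j = c *: u i j) ->
    1 \in B -> \sum_i lam i *: f i \in B -> \sum_i \sum_j u i j \in B ->
  B = fullv :> {vspace R}.
Proof.
move=> of_ injl uu dim1 B1 Ba Bu; have [ff f1 f0] := of_.
have Bf i : f i \in B.
  (* Lagrange interpolation: evaluated at the diagonal element, [p] gives a nonzero multiple of
     [f i]. *)
  pose p := \prod_(j | j != i) ('X - (lam j)%:P).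
  have Bp q : horner_alg (\sum_i lam i *: f i) q \in B.
    elim/poly_ind: q => [|q c IHq]; first by rewrite rmorph0 mem0v.
    by rewrite rmorphD rmorphM /= horner_algX horner_algC rpredD ?memvM // memvZ.
  have := Bp p; rewrite (horner_diag _ _ of_) (bigD1 i) //= big1 ?addr0 => [|j ji].
    rewrite -[f i in X in _ -> X](scalerK (a := p.[lam i])).
      by move=> Bpf; rewrite memvZ.
    rewrite horner_prod; apply/prodf_neq0 => j ji.
    by rewrite hornerXsubC subr_eq0 (inj_eq injl) eq_sym.
  by rewrite horner_prod (bigD1 j) //= hornerXsubC subrr mul0r scale0r.
have Buij i j : u i j \in B.
  have -> : u i j = f i * (\sum_i \sum_j u i j) * f j; last by rewrite !memvM.
  rewrite mulr_sumr mulr_suml (bigD1 i) //= [X in _ + X]big1 ?addr0 => [|i' ii].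
    rewrite mulr_sumr mulr_suml (bigD1 j) //= uu big1 ?addr0 // => j' jj.
    by rewrite -uu -!mulrA ff (negPf jj) !mulr0.
  rewrite mulr_sumr mulr_suml big1 // => j' _.
  by rewrite -uu !mulrA ff eq_sym (negPf ii) !mul0r.
apply/eqP; rewrite eqEsubv subvf; apply/subvP => z _.
rewrite -[z]mul1r -[z]mulr1 -f1 mulr_sumr mulr_sumr memv_suml // => j _.
rewrite mulr_suml memv_suml // => i _; rewrite mulrA.
by have [c ->] := dim1 i j z; rewrite memvZ.
Qed.

End RegularAlgebra.

(** * Base change of separable algebras *)

Local Notation vb := (vbasis {:_}).

(** By projectivity the surjection x |-> x . 1 from the enveloping algebra onto A has a linear
    section [h], and [h 1] is the separability idempotent. The second property is the [l]-th
    coordinate of its invariance. *)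
Lemma separable_idempotent (k : fieldType) (A : falgType k) : separable_alg A ->
  exists s : 'I_(\dim {:A}) -> A,
    \sum_i tnth vb i * s i = 1 /\
    forall a l, s l * a = \sum_i coord vb l (a * tnth vb i) *: s i.
Proof.
move=> sepA; pose T := enveloping_alg A; pose M := regular_bimodule A.
pose o : M := (1 : A).
pose g (x : T^o) : M := (x : T) *: o.
have g_lin : linear g by move=> c x y; rewrite /g scalerDl scalerA.
pose g_mix := GRing.isLinear.Build T T^o M _ g g_lin.
pose G : {linear T^o -> M} := HB.pack g g_mix.
have gP q : exists p, G p = q.
  exists (pure_tensor (@central_in_alg_op _ A) q 1).
  by rewrite /G /= /g [LHS]enveloping_act_pure !mulr1.
have [h gh] := sepA T^o M G idfun gP.
pose s : T := h o; exists (fun i => s 0 i : A); split.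
  transitivity (enveloping_act s o); last exact: gh o.
  by apply: eq_bigr => i _; rewrite mulr1.
have hM (x : T) : h (x *: o) = x * s by rewrite linearZ.
move=> a l; pose tens : A -> A^c -> T := pure_tensor (@central_in_alg_op _ A).
(* Both a ⊗ 1 and 1 ⊗ a send the unit of A to [a], and [h] is linear over the enveloping algebra. *)
have as_sa : tens a 1 * s = tens 1 (a : A^c) * s.
  by rewrite -!hM; congr (h _); rewrite ![_ *: o]enveloping_act_pure /o !mulr1 mul1r.
have sE : s = \sum_i tens (tnth vb i) (s 0 i) := tensor_basis s.
have tensE b t : tens b t 0 l = coord vb l b *: (t : A) by rewrite mxE; apply: mulr_algr.
have tensM b c t u : tens b t * tens c u = tens (b * c) (t * u) by apply: mul_pure_tensor.
have -> : (s 0 l : A) * a = (tens 1 (a : A^c) * s) 0 l.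
  rewrite [in RHS]sE mulr_sumr summxE.
  under eq_bigr => i _ do rewrite tensM mul1r tensE.
  rewrite (bigD1 l) //= big1 => [|i il];
    rewrite (tnth_nth 0) coord_free ?(basis_free (vbasisP _)) //.
    by rewrite eqxx scale1r addr0.
  by rewrite [i == l](negPf il) ?[l == i]eq_sym ?(negPf il) scale0r.
rewrite -as_sa [in LHS]sE mulr_sumr summxE; apply: eq_bigr => i _.
by rewrite tensM mul1r tensE.
Qed.

Section BaseChangeRegular.

Variables (k K : fieldType) (iota : {rmorphism k -> K}) (A : falgType k).

Local Notation R := (base_change iota A).
Local Notation tbc := (@to_base_change k K iota A).

Lemma to_base_changeZ c a : tbc (c *: a) = iota c *: tbc a.
Proof.
rewrite /to_base_change pure_tensorZ; apply/rowP => i.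
by rewrite !mxE mulrCA.
Qed.

Fact to_base_change_zmod : zmod_morphism tbc.
Proof. by move=> a b; apply/rowP => i; rewrite !mxE linearB rmorphB mulrBl. Qed.

HB.instance Definition _ :=
  GRing.isZmodMorphism.Build A R (@to_base_change k K iota A) to_base_change_zmod.

Fact to_base_change_monoid : monoid_morphism tbc.
Proof. by split=> // a b; rewrite [RHS]mul_pure_tensor mulr1. Qed.

HB.instance Definition _ :=
  GRing.isMonoidMorphism.Build A R (@to_base_change k K iota A) to_base_change_monoid.

Lemma base_change_basis (x : R) : x = \sum_i x 0 i *: tbc (tnth vb i).
Proof.
rewrite [LHS]tensor_basis; apply: eq_bigr => i _.
by apply/rowP => j; rewrite !mxE mulr1 mulrC.
Qed.

Lemma to_base_change_coord a : tbc a = \sum_l iota (coord vb l a) *: tbc (tnth vb l).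
Proof. by rewrite [LHS]base_change_basis; apply: eq_bigr => l _; rewrite mxE mulr1. Qed.

Lemma separable_base_change_regular : separable_alg A -> regular R.
Proof.
move=> /separable_idempotent[s [es1 cas]].
apply: (@casimir_regular _ _ (\dim {:A}) (fun i => tbc (tnth vb i)) (fun i => tbc (s i))).
split; first by rewrite -(rmorph1 tbc) -es1 rmorph_sum; apply: eq_bigr => i _; rewrite rmorphM.
(* This is the matrix of left multiplication by [a] in the basis of the e_i ⊗ 1, expanded linearly
   in [a]. *)
move=> a; exists (\matrix_(l, i) \sum_m a 0 m * iota (coord vb l (tnth vb m * tnth vb i))).
split=> [i|l].
  rewrite [a in LHS]base_change_basis mulr_suml.
  under [RHS]eq_bigr => l _ do rewrite mxE scaler_suml.
  rewrite [RHS]exchange_big; apply: eq_bigr => m _.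
  rewrite -scalerAl -rmorphM [_ (_ * _)]to_base_change_coord scaler_sumr.
  by apply: eq_bigr => l _; rewrite scalerA.
rewrite [a in LHS]base_change_basis mulr_sumr.
under [RHS]eq_bigr => i _ do rewrite mxE scaler_suml.
rewrite [RHS]exchange_big; apply: eq_bigr => m _.
rewrite -scalerAr -rmorphM cas rmorph_sum scaler_sumr.
by apply: eq_bigr => i _; rewrite /= to_base_changeZ scalerA.
Qed.

End BaseChangeRegular.

(** * Krylov matrices and polynomial relations *)

Section Krylov.

Variables (F : fieldType) (R : falgType F) (d : nat) (c : {linear R -> 'rV[F]_d}).
Hypothesis injc : injective c.

Lemma horner_alg_wide (x : R) m (q : {poly F}) : (size q <= m)%N ->
  horner_alg x q = \sum_(i < m) q`_i *: x ^+ i.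
Proof.
move=> sq; rewrite /horner_alg /horner_morph (horner_coef_wide (n := m)); last first.
  exact: leq_trans (size_poly _ _) sq.
by apply: eq_bigr => i _; rewrite coef_map /= mulr_algl.
Qed.

(** Its left kernel consists of the polynomials of size at most [m] that annihilate [f] at [x].
    Minimality of a degree thus becomes a rank condition, which survives field extensions. *)
Definition krylov m (x f : R) : 'M[F]_(m, d) := \matrix_(i, l) c (x ^+ i * f) 0 l.

Lemma mul_krylov m (x f : R) (u : 'rV_m) :
  u *m krylov m x f = c (horner_alg x (rVpoly u) * f).
Proof.
rewrite (horner_alg_wide x (size_poly _ _)) mulr_suml linear_sum mulmx_sum_row.
apply: eq_bigr => i _; rewrite -scalerAl linearZ coef_rVpoly_ord; congr (_ *: _).
by apply/rowP => l; rewrite !mxE.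
Qed.

Lemma krylovP m (x f : R) :
  reflect (forall q : {poly F}, (size q <= m)%N -> horner_alg x q * f = 0 -> q = 0)
          (row_free (krylov m x f)).
Proof.
apply: (iffP idP) => [fK q sq qf | qP].
  have /eqP := mul_krylov x f (poly_rV q : 'rV_m).
  rewrite poly_rV_K // qf linear0 mulmx_free_eq0 // => /eqP q0.
  by rewrite -(poly_rV_K sq) q0 linear0.
rewrite -kermx_eq0; apply/eqP/row_matrixP => i; rewrite row0.
apply: (can_inj rVpolyK); rewrite linear0; apply: qP; first exact: size_poly.
by apply: injc; rewrite -mul_krylov linear0 -row_mul mulmx_ker row0.
Qed.

End Krylov.

(** * Extension of the base field along a tower *)

Section BaseChangeMap.

Variables (k L L' : fieldType) (A : falgType k).
Variables (iota : {rmorphism k -> L}) (j : {rmorphism L -> L'}).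

Local Notation R := (base_change iota A).
Local Notation R' := (base_change (j \o iota) A).

(** The identity, named in order to carry a linear structure from the algebra to row vectors. *)
Definition base_change_coord (K : fieldType) (i : {rmorphism k -> K})
  (x : base_change i A) : 'rV[K]_(\dim {:A}) := x.

HB.instance Definition _ (K : fieldType) (i : {rmorphism k -> K}) :=
  GRing.isLinear.Build K (base_change i A) 'rV[K]_(\dim {:A}) *:%R (@base_change_coord K i)
    (fun a x y => erefl).

Definition base_change_map : {rmorphism R -> R'} :=
  @tensor_map k A L L' iota (@central_base _ _ iota) (j \o iota)
    (@central_base _ _ (j \o iota)) j (fun=> erefl).

Lemma base_change_mapZ a x : base_change_map (a *: x) = j a *: base_change_map x.
Proof. exact: map_mxZ. Qed.

Lemma base_change_map_inj : injective base_change_map.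
Proof. exact: map_mx_inj. Qed.

Lemma krylov_map m (x f : R) :
  map_mx j (krylov (@base_change_coord _ iota) m x f) =
  krylov (@base_change_coord _ (j \o iota)) m (base_change_map x) (base_change_map f).
Proof.
by apply/matrixP => i l; rewrite !mxE -rmorphXn -rmorphM [in RHS]mxE.
Qed.

End BaseChangeMap.

(** * Refining orthogonal idempotents *)

Section Refinement.

Variables (k L : fieldType) (A : falgType k) (iota : {rmorphism k -> L}).
Hypothesis sepA : separable_alg A.

Local Notation R := (base_change iota A).

Lemma horner_alg_base_change_map (L' : fieldType) (j : {rmorphism L -> L'}) (x : R) q :
  base_change_map A iota j (horner_alg x q) =
  horner_alg (base_change_map A iota j x) (map_poly j q).
Proof.
rewrite (horner_alg_wide _ (leqnn _)) (@horner_alg_wide _ _ _ (size q)) ?size_map_poly //.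
rewrite rmorph_sum; apply: eq_bigr => i _.
by rewrite base_change_mapZ rmorphXn coef_map.
Qed.

Lemma horner_alg_comm (F : fieldType) (B : falgType F) (x y : B) (q : {poly F}) :
  x * y = y * x -> horner_alg x q * y = y * horner_alg x q.
Proof.
move=> xy; elim/poly_ind: q => [|q c IHq]; first by rewrite rmorph0 mul0r mulr0.
rewrite rmorphD rmorphM /= horner_algX horner_algC mulrDl mulrDr -scalerAl -scalerAr mul1r mulr1.
by rewrite -mulrA xy mulrA IHq !mulrA.
Qed.

Lemma idem_decomp_map (L' : fieldType) (j : {rmorphism L -> L'}) (I : finType) (f : I -> R) :
  idem_decomp f -> idem_decomp (fun i => base_change_map A iota j (f i)).
Proof.
move=> [ff f1 f0]; split=> [i l||i].
- by rewrite -rmorphM ff; case: ifP => // _; rewrite rmorph0.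
- by rewrite -rmorph_sum f1 rmorph1.
by rewrite -(rmorph0 (base_change_map A iota j)) (inj_eq (@base_change_map_inj _ _ _ _ _ _)).
Qed.

(** If the corner of [f] has no proper idempotent over L, the minimal polynomial [p] of [x] in it is
    irreducible of degree at least 2. Over an extension with a root [t] of [p], the factorisation
    [p = q * ('X - t)] yields zero divisors, hence an idempotent. *)
Lemma corner_idempotent_extension (f x : R) :
    f * f = f -> f != 0 -> f * x = x -> x * f = x -> (forall c, x <> c *: f) ->
  exists (L' : fieldType) (j : {rmorphism L -> L'}) (e' : base_change (j \o iota) A),
    let f' := base_change_map A iota j f in
    [/\ e' * e' = e', f' * e' = e', e' * f' = e', e' != 0 & e' != f'].
Proof.
move=> ff f0 fx xf nx.
have reg := @separable_base_change_regular _ _ iota _ sepA.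
have [[e0 [ee fe ef e00 e0f]]|noe] :=
  classic (exists e, [/\ e * e = e, f * e = e, e * f = e, e != 0 & e != f]).
  pose j : {rmorphism L -> L} := idfun.
  exists L, j, (base_change_map A iota j e0).
  split; rewrite -?rmorphM ?ee ?fe ?ef //;
    last by rewrite (inj_eq (@base_change_map_inj _ _ _ _ _ _)).
  by rewrite -(rmorph0 (base_change_map A iota j)) (inj_eq (@base_change_map_inj _ _ _ _ _ _)).
pose c := @base_change_coord k A L iota.
have injc : injective c by [].
(* The least such [m] is one more than the degree of the minimal polynomial; [\dim {:A} + 1] rows
   are always dependent. *)
have exm : exists m, ~~ row_free (krylov c m x f).
  exists (\dim {:A}).+1; apply/negP => /eqP rK.
  by have := rank_leq_col (krylov c (\dim {:A}).+1 x f); rewrite rK ltnn.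
case: (ex_minnP exm) => m nfm minm.
have [p [sp pf p0]] : exists p : {poly L}, [/\ (size p <= m)%N, horner_alg x p * f = 0 & p != 0].
  apply: NNPP => nop; case/negP: nfm; apply/(krylovP injc) => q sq qf.
  by apply: NNPP => /eqP q0; apply: nop; exists q.
have small (q : {poly L}) : (size q < m)%N -> horner_alg x q * f = 0 -> q = 0.
  move=> sq; have : row_free (krylov c m.-1 x f).
    by apply: contraTT sq => /minm; rewrite -leqNgt; case: (m) => // n; rewrite ltnn.
  by move/(krylovP injc); apply; rewrite -ltnS (ltn_predK sq).
have sizep : size p = m.
  by apply/eqP; rewrite eqn_leq sp leqNgt; apply: contraNN p0 => /small ->.
(* A nonzero relation of degree at most 1 would make [x] a multiple of [f]. *)
have m3 : (2 < m)%N.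
  rewrite -sizep ltnNge; apply/negP => sp2; move: pf p0.
  rewrite (horner_alg_wide x sp2) big_ord_recl big_ord1 expr0 expr1 /=.
  rewrite mulrDl -!scalerAl mul1r xf => /eqP.
  have [p10|p10] := eqVneq p`_1 0.
    rewrite p10 scale0r addr0 scaler_eq0 (negPf f0) orbF => /eqP p00 /eqP[].
    apply/polyP => -[|[|i]]; rewrite coef0 // nth_default //.
    exact: leq_trans sp2 _.
  rewrite addrC addr_eq0 => /eqP xE; case: (nx (- (p`_1)^-1 * p`_0)).
  by rewrite -scalerA scaleNr -scalerN -xE scalerK.
have fH (q : {poly L}) : f * horner_alg x q = horner_alg x q * f.
  by rewrite horner_alg_comm // fx.
have fHf (q : {poly L}) : f * (horner_alg x q * f) = horner_alg x q * f.
  by rewrite mulrA fH -mulrA ff.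
have Hff (q : {poly L}) : horner_alg x q * f * f = horner_alg x q * f by rewrite -mulrA ff.
(* For a proper factorisation [p = r * q], both factors are nonzero on [f] by minimality, and their
   product vanishes there; this gives an idempotent excluded by [noe]. *)
have irrp : irreducible_poly p.
  split=> [|q sq /dvdpP[r pE]]; first by rewrite sizep (ltn_trans _ m3).
  have : r != 0 by apply: contraNneq p0 => r0; rewrite pE r0 mul0r.
  have : q != 0 by apply: contraNneq p0 => q0; rewrite pE q0 mulr0.
  move=> q0 r0; have spE := size_mul r0 q0.
  rewrite -dvdp_size_eqp ?pE ?dvdp_mulIr // -pE.
  apply: contraT => sqp; case: noe.
  have q_gt0 : (0 < size q)%N by rewrite size_poly_gt0.
  have r_gt0 : (0 < size r)%N by rewrite size_poly_gt0.
  have spq : size p = (size r + (size q).-1)%N by rewrite pE spE -[in LHS](prednK q_gt0) addnS.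
  apply: (@corner_idempotent _ _ f (horner_alg x r * f) (horner_alg x q * f)) => //.
  - apply: contraNneq r0 => /small -> //; rewrite -sizep spq -[ltnLHS]addn0 ltn_add2l.
    by move: sq q_gt0; case: (size q) => [|[|]].
  - apply: contraNneq q0 => /small -> //.
    rewrite -sizep ltn_neqAle sqp spq.
    by move: q_gt0; case: (size q) => // n _; rewrite -add1n leq_add2r.
  by rewrite -mulrA fHf mulrA -rmorphM -pE.
have [L' [j [t pt]]] := exists_root_extension irrp.
pose h := base_change_map A iota j; exists L', j.
have reg' := @separable_base_change_regular _ _ (j \o iota) _ sepA.
(* Minimality persists over L' because [j] preserves the freeness of the rows of the Krylov
   matrix. *)
have small' (q : {poly L'}) : (size q < m)%N -> horner_alg (h x) q * h f = 0 -> q = 0.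
  move=> sq; have : row_free (krylov c m.-1 x f).
    by apply: contraTT sq => /minm; rewrite -leqNgt; case: (m) => // n; rewrite ltnn.
  rewrite -(row_free_map j) krylov_map => /krylovP; apply => //.
  by rewrite -ltnS (ltn_predK sq).
have /factor_theorem[q pE] := pt.
have p'0 : map_poly j p != 0 by rewrite map_poly_eq0.
have q0 : q != 0 by apply: contraNneq p'0 => q0; rewrite pE q0 mul0r.
have sq : (size q).+1 = m.
  by rewrite -sizep -(size_map_poly j) pE size_Mmonic ?monicXsubC // size_XsubC addn2.
have hff : h f * h f = h f by rewrite -rmorphM ff.
have hfx : h x * h f = h f * h x by rewrite -!rmorphM fx xf.
have fH' (r : {poly L'}) : h f * (horner_alg (h x) r * h f) = horner_alg (h x) r * h f.
  by rewrite mulrA -horner_alg_comm // -mulrA hff.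
have Hf' (r : {poly L'}) : horner_alg (h x) r * h f * h f = horner_alg (h x) r * h f.
  by rewrite -mulrA hff.
have [|||||||e' e'P] := @corner_idempotent _ _ (h f) (horner_alg (h x) q * h f)
    (horner_alg (h x) ('X - t%:P) * h f) reg'; last by exists e'.
- exact: hff.
- exact: fH'.
- exact: Hf'.
- exact: Hf'.
- by apply: contraNneq q0 => /small' ->; rewrite // -sq.
- apply/eqP => /small' /eqP; rewrite size_XsubC polyXsubC_eq0 => /(_ m3).
  by [].
have hH : h (horner_alg x p) = horner_alg (h x) (map_poly j p) := horner_alg_base_change_map j x p.
by rewrite -mulrA fH' mulrA -rmorphM -pE /= -hH -rmorphM pf rmorph0.
Qed.

Lemma idem_decomp_refine (I : finType) (f : I -> R) i x : idem_decomp f ->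
    (forall c, f i * x * f i <> c *: f i) ->
  exists (L' : fieldType) (j : {rmorphism L -> L'}) (f' : option I -> base_change (j \o iota) A),
    idem_decomp f'.
Proof.
move=> of_ nx; have [ff f1 f0] := of_.
have [|||L' [j [e' [ee fe ef e0 ef']]]] :=
  @corner_idempotent_extension (f i) (f i * x * f i) _ (f0 i) _ _ nx.
- by rewrite ff eqxx.
- by rewrite !mulrA ff eqxx.
- by rewrite -mulrA ff eqxx.
exists L', j; eexists; exact: (idem_decomp_split (idem_decomp_map j of_) ee fe ef e0 ef').
Qed.

End Refinement.

(** * Generic minors *)

Lemma dim_base_change (k K : fieldType) (iota : {rmorphism k -> K}) (A : falgType k) :
  \dim {:base_change iota A} = \dim {:A}.
Proof. by rewrite dimvf /dim /= mul1n. Qed.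

Lemma two_generated (F : fieldType) (R : falgType F) (I : finType) (f : I -> R) n :
    infinite_field F -> regular R -> idem_decomp f ->
    (forall i x, exists c, f i * x * f i = c *: f i) -> (1 < n)%N ->
  exists a : n.-tuple R, generating a.
Proof.
move=> infF reg of_ dim1 n_gt1.
have [s us ss] := infinite_uniq infF #|I|.
pose lam (i : I) := nth 0 s (enum_rank i).
have injl : injective lam.
  move=> i j /eqP; rewrite nth_uniq ?ss ?ltn_ord // => /eqP/val_inj; exact: enum_rank_inj.
pose uspec i j (u : R) := f i * u * f j = u /\ forall z, exists c, f i * z * f j = c *: u.
(* As [I] is finite, the spanning elements of all corners can be chosen simultaneously. *)
have /fin_all_exists[u uP] i : exists ui : I -> R, forall j, uspec i j (ui j).
  have uiP j : exists u, uspec i j u.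
    by have [u uu uz] := corner_dim1 reg of_ dim1 i j; exists u.
  by have [ui] := fin_all_exists uiP; exists ui.
pose a1 := \sum_i lam i *: f i; pose a2 := \sum_i \sum_j u i j.
pose i1 := Ordinal (ltnW n_gt1); pose i2 := Ordinal n_gt1.
pose a := [tuple if l == i1 then a1 else if l == i2 then a2 else 0 | l < n].
have aB l : tnth a l \in agenv_aspace (1 + <<a>>)%VS.
  exact: seqv_sub_adjoin (mem_tnth _ _).
exists a; apply: (@idem_decomp_generated _ _ I f lam u (agenv_aspace (1 + <<a>>)%VS) of_ injl).
- by move=> i j; case: (uP i j).
- by move=> i j; case: (uP i j).
- by rewrite memvE sub1_agenv.
- by have := aB i1; rewrite tnth_mktuple eqxx.
by have := aB i2; rewrite tnth_mktuple.
Qed.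

Lemma separable_generated (k : fieldType) (A : falgType k) n :
    separable_alg A -> (1 < n)%N ->
  exists (L : fieldType) (iota : {rmorphism k -> L}) (x : n.-tuple (base_change iota A)),
    generating x.
Proof.
move=> sepA n_gt1.
(* [m] bounds the refinements still possible: each adds one idempotent, and [m = 0] would give more
   than [\dim {:A}] of them. The start is the trivial decomposition of 1 over an infinite field. *)
suff main m : forall (L : fieldType) (iota : {rmorphism k -> L}) (I : finType)
    (f : I -> base_change iota A), infinite_field L -> idem_decomp f ->
    (\dim {:A} < m + #|I|)%N ->
    exists (L : fieldType) (iota : {rmorphism k -> L}) (x : n.-tuple (base_change iota A)),
      generating x.
  have [L [iota infL]] := exists_infinite_extension k.
  apply: (main (\dim {:A}) L iota unit (fun=> 1)) => //; last by rewrite card_unit addn1.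
  split=> [i j|| i]; last exact: oner_neq0.
    by rewrite mulr1; case: i j => -[].
  by rewrite big_const card_unit /= addr0.
elim: m => [|m IHm] L iota I f infL of_.
  by have := idem_decomp_card of_; rewrite dim_base_change leqNgt => /negP.
have reg := @separable_base_change_regular _ _ iota _ sepA.
have [dim1 _|ndim1] := classic (forall i x, exists c, f i * x * f i = c *: f i).
  by have [x gx] := two_generated infL reg of_ dim1 n_gt1; exists L, iota, x.
have [i [x nx]] : exists i x, forall c, f i * x * f i <> c *: f i.
  apply: NNPP => nix; case: ndim1 => i x; apply: NNPP => nc; case: nix.
  by exists i, x => c fc; apply: nc; exists c.
have [L' [j [f' of']]] := idem_decomp_refine sepA of_ nx.
rewrite addSnnS -card_option; apply: IHm of'.
exact: infinite_morph j infL.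
Qed.

Section GenericMinors.

Variables (k : fieldType) (A : falgType k) (n : nat).

Local Notation d := (\dim {:A}).
Local Notation S := {mpoly k[n * d]}.

Fact central_mpolyC : central_map (@mpolyC (n * d) k). Proof. by move=> c s; rewrite mulrC. Qed.

(** The numbering of the variables agrees with that of the coordinates in [point]. *)
Definition generic_element (l : 'I_n) : tensor_alg A central_mpolyC :=
  \row_j 'X_(mxvec_index l j).

Definition generic_minor (w : 'I_d -> seq 'I_n) : S :=
  \det (\matrix_(i, j) (word generic_element (w i) : 'rV_d) 0 j).

(** Evaluation at [point x] is a ring morphism from polynomials to K; tensored with A, it sends the
    generic elements to the components of [x]. Words and determinants commute with ring
    morphisms. *)
Lemma generic_minor_eval (K : fieldType) (iota : {rmorphism k -> K})
    (x : n.-tuple 'rV[K]_d) w :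
  (map_mpoly iota (generic_minor w)).@[point x] =
  \det (\matrix_(i, j)
    (word (fun l => tnth x l : base_change iota A) (w i) : 'rV[K]_d) 0 j).
Proof.
pose psi : {rmorphism S -> K} := meval (point x) \o map_mpoly iota.
have psiE c : psi (mpolyC _ c) = iota c by rewrite /psi /= map_mpolyC mevalC.
rewrite -[LHS]/(psi _) -det_map_mx; congr (\det _); apply/matrixP => i j.
pose h : {rmorphism tensor_alg A central_mpolyC -> base_change iota A} :=
  @tensor_map k A S K (@mpolyC (n * d) k) central_mpolyC iota (@central_base _ _ iota)
    psi psiE.
rewrite mxE; transitivity ((h (word generic_element (w i)) : 'rV_d) 0 j).
  by rewrite !mxE.
rewrite (rmorph_word h) [RHS]mxE.
rewrite (@eq_word _ _ _ (fun l => tnth x l : base_change iota A)) // => l.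
apply/rowP => m; rewrite !mxE /psi /= map_mpolyX mevalXU.
by rewrite /point mxvecE mxE.
Qed.

Lemma generating_base_change (K : fieldType) (iota : {rmorphism k -> K})
    (x : n.-tuple (base_change iota A)) :
  generating x <-> exists w, (map_mpoly iota (generic_minor w)).@[point x] != 0.
Proof.
have bij : bijective (@base_change_coord k A K iota) by exists id.
have gP := generatingP x bij.
by split=> [/gP|] [w ww]; [|apply/gP]; exists w; move: ww; rewrite generic_minor_eval.
Qed.

Lemma coord_row_linear : linear (@coord_row k A).
Proof. by move=> c a b; apply/rowP => i; rewrite !mxE linearP. Qed.

HB.instance Definition _ :=
  GRing.isLinear.Build k A 'rV[k]_d *:%R (@coord_row k A) coord_row_linear.

Lemma coord_rowK (u : 'rV_d) : coord_row (\sum_j u 0 j *: tnth (vbasis {:A}) j) = u.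
Proof.
apply/rowP => j; rewrite mxE.
under eq_bigr do rewrite (tnth_nth 0).
by rewrite coord_sum_free // (basis_free (vbasisP _)).
Qed.

(** At a tuple coming from A the minor is the image of a determinant over k, so its vanishing does
    not depend on K. *)
Lemma generic_minor_to_base_change (K : fieldType) (iota : {rmorphism k -> K})
    (a : n.-tuple A) w :
  (map_mpoly iota (generic_minor w)).@[point (map_tuple (@to_base_change k K iota A) a)] =
  iota (\det (\matrix_(i, j) coord_row (word (tnth a) (w i)) 0 j)).
Proof.
rewrite generic_minor_eval -det_map_mx; congr (\det _); apply/matrixP => i l; rewrite !mxE.
have -> : word (fun l => tnth (map_tuple (@to_base_change k K iota A) a) l : base_change iota A)
    (w i) =
    word (@to_base_change k K iota A \o tnth a) (w i).
  by apply: eq_word => m; rewrite tnth_map.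
by rewrite -(rmorph_word (@to_base_change k K iota A)) mxE mulr1.
Qed.

Lemma generic_minor_coord (a : n.-tuple A) w :
  (generic_minor w).@[point (map_tuple (@coord_row k A) a)] =
  \det (\matrix_(i, j) coord_row (word (tnth a) (w i)) 0 j).
Proof.
pose j : {rmorphism k -> k} := idfun.
rewrite -[RHS](generic_minor_to_base_change j).
have <- : generic_minor w = map_mpoly j (generic_minor w).
  by apply/mpolyP => m; rewrite mcoeff_map_mpoly.
apply: meval_eq => p; rewrite /point; congr (mxvec _ 0 p).
by apply/matrixP => i l; rewrite !mxE !tnth_map !mxE mulr1.
Qed.

Lemma generating_alg (a : n.-tuple A) :
  generating a <-> exists w, (generic_minor w).@[point (map_tuple (@coord_row k A) a)] != 0.
Proof.
have bij : bijective (@coord_row k A).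
  exists (fun u : 'rV[k]_d => \sum_j u 0 j *: tnth (vbasis {:A}) j) => [b|u];
    last exact: coord_rowK.
  rewrite [RHS](coord_vbasis (memvf b)); apply: eq_bigr => j _.
  by rewrite mxE (tnth_nth 0).
have gP := generatingP a bij.
by split=> [/gP|] [w ww]; [|apply/gP]; exists w; move: ww; rewrite generic_minor_coord.
Qed.

(** A single generating tuple over some extension field shows that a minor is nonzero as a
    polynomial over k. *)
Lemma generic_minor_neq0 : separable_alg A -> (1 < n)%N -> exists w, generic_minor w != 0.
Proof.
move=> sepA n_gt1.
have [L [iota [x /generating_base_change[w ww]]]] := separable_generated sepA n_gt1.
by exists w; apply: contraNneq ww => ->; rewrite !rmorph0.
Qed.

End GenericMinors.

(** * Density of nonvanishing loci, and the theorem *)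

Lemma zariski_dense_mpoly (F : fieldType) N (V : ('I_N -> F) -> Prop) (h : {mpoly F[N]}) :
  infinite_field F -> h != 0 -> (forall v, h.@[v] != 0 -> V v) -> zariski_dense V.
Proof.
move=> infF h0 hV P [v [g Pg gv]].
have g0 : g != 0 by apply: contraNneq gv => ->; rewrite rmorph0.
(* A point where [g * h] does not vanish lies in both open sets. *)
have [v'] := meval_neq0 infF (mulf_neq0 g0 h0).
rewrite mevalM mulf_eq0 negb_or => /andP[gv' hv'].
by exists v'; [exists g | apply: hV].
Qed.

Theorem theoremC (k : fieldType) (A : falgType k) (n : nat) (n_gt0 : (0 < n)%N) :
  exists U : {mpoly k[n * \dim {:A}]} -> Prop,
    [/\ (* Gen_n(A) is the set of k-rational points of the open subscheme U, *)
        forall a : n.-tuple A,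
          generating a <-> open_points U (point (map_tuple (@coord_row k A) a)),
        (* also when seen inside the affine space over any algebraically
           closed K over k, where the K-points of U are the generating tuples
           of A (x)_k K, *)
        forall (K : closedFieldType) (iota : {rmorphism k -> K}),
          (forall a : n.-tuple A,
             generating a <->
             open_points (extend_open iota U)
               (point (map_tuple (@to_base_change k K iota A) a))) /\
          (forall x : n.-tuple (base_change iota A),
             generating x <-> open_points (extend_open iota U) (point x))
      & (* and density holds for U over K, and for Gen_n(A) itself if k is
           infinite (for k finite Gen_n(A) may be empty while U is dense,
           for instance for A a large power of F_2). *)
        (2 <= n)%N -> separable_alg A ->
          (forall (K : closedFieldType) (iota : {rmorphism k -> K}),
             zariski_dense (open_points (extend_open iota U))) /\
          (infinite_field k ->
             zariski_dense (fun v => exists2 a : n.-tuple A,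
               generating a & v =1 point (map_tuple (@coord_row k A) a)))].
Proof.
have gen_ext (K : fieldType) (iota : {rmorphism k -> K}) (v : 'I_(n * \dim {:A}) -> K) :
    open_points (extend_open iota (fun f => exists w, f = @generic_minor k A n w)) v <->
    exists w, (map_mpoly iota (@generic_minor k A n w)).@[v] != 0.
  split=> [[_ [_ [w ->] ->] fv]|[w wv]]; first by exists w.
  by exists (map_mpoly iota (generic_minor w)) => //; exists (generic_minor w) => //; exists w.
exists (fun f => exists w, f = @generic_minor k A n w); split.
- move=> a; apply: iff_trans (generating_alg a) _.
  split=> [[w wa]|[_ [w ->] wa]]; last by exists w.
  by exists (generic_minor w) => //; exists w.
- move=> K iota; split=> [a|x]; last first.
    exact: iff_trans (generating_base_change x) (iff_sym (gen_ext _ _ _)).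
  apply: iff_trans (generating_alg a) _; apply: iff_trans _ (iff_sym (gen_ext _ _ _)).
  by split=> -[w wa]; exists w; move: wa;
    rewrite generic_minor_to_base_change fmorph_eq0 generic_minor_coord.
move=> n_gt1 sepA; have [w w0] := generic_minor_neq0 sepA n_gt1.
split=> [K iota|infk].
  apply: (@zariski_dense_mpoly _ _ _ (map_mpoly iota (generic_minor w))).
  - exact: infinite_closed.
  - apply: contraNneq w0 => w0; apply/eqP/mpolyP => m; apply/eqP.
    by rewrite mcoeff0 -(fmorph_eq0 iota) -mcoeff_map_mpoly w0 mcoeff0.
  by move=> v wv; apply/gen_ext; exists w.
apply: (zariski_dense_mpoly infk w0) => v wv.
(* Every k-rational point is the coordinate vector of a tuple of A, here rebuilt from [v]. *)
pose a := [tuple \sum_j v (mxvec_index l j) *: tnth (vbasis {:A}) j | l < n].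
have va : v =1 point (map_tuple (@coord_row k A) a).
  move=> p; case/mxvec_indexP: p => l j; rewrite /point mxvecE mxE tnth_map tnth_mktuple.
  have := coord_rowK (\row_j v (mxvec_index l j)) => /rowP/(_ j).
  by rewrite [in RHS]mxE => <-; congr (coord_row _ 0 j); apply: eq_bigr => m _; rewrite mxE.
exists a => //; apply/generating_alg; exists w.
by rewrite -(meval_eq _ va).
Qed.
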